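(* The set $\{h(E(S)) : S\in\mathbf{G}\}\subseteq\mathbb{R}$ is a perfect set.
   Context: Let $\mathbf{G}$ be the set of all finite or infinite (strictly) increasing sequences of positive integers beginning with $1$; a sequence is identified with the set of its terms. For $S\in\mathbf{G}$, a positive integer $N$ is called an exponentially $S$-number, written $N\in E(S)$, if all exponents in its prime power factorization belong to $S$ (so $1\in E(S)$ vacuously). For every $S\in\mathbf{G}$, $h(E(S))$ denotes the natural density of $E(S)$, i.e. $h(E(S))=\lim_{x\to\infty}\frac1x\#\{i\le x: i\in E(S)\}$. It is known from earlier work that this density exists, lies in $[\frac{6}{\pi^2},1]$, and equals $$h(E(S))=\prod_{p}\Bigl(1+\sum_{i\ge2}\frac{u(i)-u(i-1)}{p^i}\Bigr),$$ where $p$ runs over all primes and $u$ is the characteristic function of $S$ ($u(n)=1$ if $n\in S$, $u(n)=0$ otherwise). A perfect set is a closed set without isolated points. *)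

(* Defs.v *)
From HB Require Import structures.
From mathcomp Require Import all_boot all_order all_algebra.
From mathcomp Require Import all_classical all_reals all_analysis.

Set Implicit Arguments.
Unset Strict Implicit.
Unset Printing Implicit Defensive.

Import Order.TTheory GRing.Theory Num.Theory.
Import numFieldNormedType.Exports.

Local Open Scope classical_set_scope.
Local Open Scope ring_scope.

(* A finite or infinite strictly increasing sequence of positive integers
   beginning with 1 is identified with the set of its terms, i.e. with a set of
   positive integers that contains 1. *)
Definition exponent_sets : set (set nat) := [set S | S 1%N /\ ~ S 0%N].

(* [logn p N] is the exponent of [p] in the factorization of [N]; only the
   primes dividing [N] are constrained. *)
Definition exponentially (S : set nat) : set nat :=
  [set N | (0 < N)%N /\ forall p : nat, prime p -> (p %| N)%N -> S (logn p N)].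

Definition count_upto (A : set nat) (n : nat) : nat :=
  #|[pred i : 'I_n.+1 | (0 < i)%N && ((i : nat) \in A)]|.

(* [lim] is a total operator: the value is meaningful only when the sequence
   converges, as it is known to do when [A] is of the form [exponentially S] with
   [S] in [exponent_sets]. The term of index 0 is [0 / 0 = 0]. *)
Definition density (R : realType) (A : set nat) : R :=
  lim (((count_upto A n)%:R / n%:R : R) @[n --> \oo]).

(* Main.v *)
Require Import Defs.
From mathcomp Require Import all_boot all_order all_algebra.
From mathcomp Require Import all_classical all_reals all_analysis.
From mathcomp Require Import zify ring lra.
Import Order.TTheory GRing.Theory Num.Theory.
Import numFieldNormedType.Exports.

(** Write [h S] for the density of [exponentially S].

    The exponents in [S] that are at least [2 * L] hardly matter. If [S] and [S']
    have the same elements below [2 * L] and [N] is in [exponentially S] but not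
    in [exponentially S'], then some prime [p] occurs in [N] with an exponent at
    least [2 * L], so [N] is a multiple of [d ^ 2] with [d = p ^ L > L]. Since the
    sum of [1 / d ^ 2] over [d > L] is at most [1 / L], the proportion of such
    integers in every initial segment is at most [1 / L]
    ([le_frequency_square_multiples]). Everything rests on this bound, and the
    Euler product for [h S] is avoided.

    Existence of [h S] ([frequency_exponentially_cvg]): for [L > 0] put
    [M = L! ^ (2 * L)]. The integers whose gcd with [M] is that of an element of
    [exponentially S] form an [M]-periodic set, which contains [exponentially S]
    and exceeds it only by multiples of squares [d ^ 2] with [d > L]. So the
    frequencies are within about [1 / L] of a convergent sequence, for every
    [L], and are therefore Cauchy.

    Closedness: by the same bound [|h S - h S'| <= 1 / L] when [S] and [S'] agree
    below [2 * L], so [h] is continuous for the product topology on subsets of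
    the naturals, and its range is the continuous image of the Cantor space.

    No isolated points: adding to [S] (or removing from it) one large [m] moves
    [h S] by little, but it does move it ([density_lt_setU1]): the integers
    [2 ^ m * b] with [b] odd and squarefree, which have positive lower density,
    are gained (or lost). *)

Set Implicit Arguments.
Unset Strict Implicit.
Unset Printing Implicit Defensive.

Local Open Scope classical_set_scope.

(** * Counting the elements of a set of integers *)

Lemma count_uptoE (A : set nat) n :
  count_upto A n = \sum_(1 <= i < n.+1) (i \in A).
Proof.
rewrite /count_upto -sum1_card big_mkcond /=.
rewrite -(big_mkord xpredT
  (fun i => if [pred i | (0 < i) && (i \in A)] i then 1 else 0)).
rewrite big_ltn //= add0n; apply: eq_big_nat => i /andP[i0 _].
by rewrite i0; case: (i \in A).
Qed.

Lemma count_upto_sub (A B : set nat) n :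
  (forall i, 0 < i -> A i -> B i) -> count_upto A n <= count_upto B n.
Proof.
move=> AB; rewrite !count_uptoE !big_nat; apply: leq_sum => i /andP[i0 _].
case: (boolP (i \in A)) => // /set_mem Ai.
by rewrite (mem_set (AB i i0 Ai)).
Qed.

Lemma count_upto_setU (A B : set nat) n :
  count_upto (A `|` B) n <= count_upto A n + count_upto B n.
Proof.
rewrite !count_uptoE -big_split /=; apply: leq_sum => i _.
by rewrite in_setU; do 2 case: (i \in _).
Qed.

Lemma count_upto_disjoint (A B : set nat) n : A `&` B = set0 ->
  count_upto (A `|` B) n = count_upto A n + count_upto B n.
Proof.
move=> AB; rewrite !count_uptoE -big_split /=; apply: eq_bigr => i _.
have : i \notin A `&` B by rewrite AB in_set0.
by rewrite in_setU in_setI; do 2 case: (i \in _).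
Qed.

Lemma count_uptoT n : count_upto setT n = n.
Proof.
rewrite count_uptoE; under eq_bigr do rewrite in_setT.
by rewrite sum_nat_const_nat muln1 subn1.
Qed.

Lemma count_upto_le (A : set nat) n : count_upto A n <= n.
Proof. by rewrite -[X in _ <= X]count_uptoT; apply: count_upto_sub. Qed.

Lemma count_upto_leq (A : set nat) m n : m <= n ->
  count_upto A m <= count_upto A n.
Proof.
move=> mn; rewrite !count_uptoE [leqRHS](@big_cat_nat _ _ _ m.+1) //=.
exact: leq_addr.
Qed.

Lemma count_upto_dvdn d n : count_upto [set i | d %| i] n = n %/ d.
Proof.
rewrite count_uptoE divn_count_dvd; apply: eq_bigr => i _; congr nat_of_bool.
by apply/idP/idP => [/set_mem|/mem_set].
Qed.

Lemma count_upto_scale (A : set nat) k n : 0 < k ->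
  count_upto [set k * b | b in A] (k * n) = count_upto A n.
Proof.
move=> k0; set kA := [set k * b | b in A].
have kAE i : (k * i \in kA) = (i \in A).
  apply/idP/idP => /set_mem; last by move=> Ai; apply: mem_set; exists i.
  by case=> b Ab /eqP; rewrite eqn_pmul2l // => /eqP <-; apply: mem_set.
elim: n => [|n IHn]; first by rewrite muln0 !count_uptoE !big_geq.
have kn : k * n.+1 = (k * n + k.-1).+1 by lia.
rewrite count_uptoE kn (@big_cat_nat _ _ _ (k * n).+1) //=; last by lia.
rewrite -count_uptoE IHn big_nat_recr /=; last by lia.
rewrite [RHS]count_uptoE [RHS]big_nat_recr //= -count_uptoE -kn kAE big_nat big1 ?add0n //.
(* The remaining sum is over the integers strictly between two consecutive
   multiples of k. *)
move=> i /andP[lt_kn_i lt_i_kn]; apply/eqP; rewrite eqb0.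
apply/negP => /set_mem[b _ kbi]; move: lt_kn_i lt_i_kn.
by rewrite -kbi !ltn_pmul2l //; lia.
Qed.

(** Cutting [1 .. q * M + n] into [q] full periods followed by [n] terms. *)
Lemma count_upto_period (A : set nat) M n q :
    (forall i, 0 < i -> (i + M \in A) = (i \in A)) ->
  count_upto A (q * M + n) = q * count_upto A M + count_upto A n.
Proof.
move=> AM; elim: q => [|q IHq] //.
rewrite mulSn -addnA [LHS]count_uptoE (@big_cat_nat _ _ _ M.+1) //=; last by lia.
rewrite -count_uptoE mulSn -addnA -IHq; congr (_ + _).
rewrite count_uptoE -[in M.+1]add1n big_addn -addnS addKn !big_nat.
by apply: eq_bigr => i /andP[i0 _]; rewrite AM.
Qed.

(** * Large exponents force large square divisors *)

(** The exceptional integers of all the approximations below. All [d > L] are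
    allowed, not only primes, so that a prime [p > L] dividing twice and a high
    power of a small prime are treated alike, through [d = p] and [d = p ^ L]. *)
Definition square_multiples (L : nat) : set nat :=
  [set N | exists2 d, L < d & d ^ 2 %| N].

Lemma exponent_ge_square_multiple L p N : prime p -> 0 < L -> 0 < N ->
  L < p \/ L <= (logn p N)./2 -> 1 < logn p N -> square_multiples L N.
Proof.
move=> pp L0 N0 pL jN; case: pL => [Lp|Lj].
  by exists p => //; rewrite pfactor_dvdn.
exists (p ^ L); first by rewrite ltn_expl ?prime_gt1.
by rewrite -expnM pfactor_dvdn //; lia.
Qed.

Lemma exponentially_approx L S S' : 0 < L ->
    (forall j, j < 2 * L -> S j -> S' j) ->
  exponentially S `<=` exponentially S' `|` square_multiples L.
Proof.
move=> L0 SS' N [N0 SN].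
have [bad|good] := pselect (square_multiples L N); [by right | left].
split=> // p pp pN; have := SN p pp pN.
have [jL|Lj] := ltnP (logn p N) (2 * L); first exact: SS'.
by case: good; apply: (exponent_ge_square_multiple pp) => //; [right|]; lia.
Qed.

Lemma count_square_multiples_le_sum L n :
  count_upto (square_multiples L) n <= \sum_(L.+1 <= d < n.+1) n %/ d ^ 2.
Proof.
under eq_bigr do rewrite divn_count_dvd.
rewrite exchange_big count_uptoE !big_nat /=; apply: leq_sum => i /andP[i0 ilen].
case: (boolP (i \in square_multiples L)) => // /set_mem[d Ld d2i].
have dn : d < n.+1.
  have d_le_d2 : d <= d ^ 2 by rewrite -mulnn leq_pmulr //; lia.
  by have := dvdn_leq i0 d2i; lia.
rewrite (@big_cat_nat _ _ _ d) //=; last by lia.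
by rewrite [X in _ + X]big_ltn // d2i; lia.
Qed.

(** * A periodic approximation of the exponentially S-numbers *)

(** The least set that contains [A] and is a union of classes for the relation
    of having the same gcd with [M]; membership depends on [N] modulo [M] only. *)
Definition gcd_saturation (M : nat) (A : set nat) : set nat :=
  [set N | exists2 N', A N' & gcdn N M = gcdn N' M].

Lemma gcd_saturation_period M A i :
  (i + M \in gcd_saturation M A) = (i \in gcd_saturation M A).
Proof.
have gcdiM : gcdn (i + M) M = gcdn i M by rewrite gcdnC gcdnDr gcdnC.
by apply/idP/idP => /set_mem[j Aj ij]; apply/mem_set; exists j;
  rewrite // ?gcdiM // -gcdiM.
Qed.

(** For a prime [p <= L] the modulus has [p]-adic valuation at least [2 * L], so
    the gcd with it determines every exponent of [p] below [2 * L]. It does not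
    see larger exponents nor primes above [L]; there the exponent is [1], which
    lies in [S], or it yields a square divisor [d ^ 2] with [d > L]. *)
Lemma gcd_saturation_exponentially L S N : 0 < L -> S 1 -> 0 < N ->
    gcd_saturation (L`! ^ (2 * L)) (exponentially S) N ->
  (exponentially S `|` square_multiples L) N.
Proof.
move=> L0 S1 N0 [N' [N'0 SN'] eqNN'].
have [bad|good] := pselect (square_multiples L N); [by right | left].
split=> // p pp pN.
have j0 : 0 < logn p N by rewrite logn_gt0 mem_primes pp N0.
have [j1|j1] := ltnP 1 (logn p N); last by rewrite (_ : logn p N = 1) //; lia.
have [pL|Lp] := leqP p L; last first.
  by case: good; apply: (exponent_ge_square_multiple pp) => //; left.
have [jL|Lj] := ltnP (logn p N) (2 * L); last first.
  by case: good; apply: (exponent_ge_square_multiple pp) => //; right; lia.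
have M0 : 0 < L`! ^ (2 * L) by rewrite expn_gt0 fact_gt0.
have LM : 2 * L <= logn p (L`! ^ (2 * L)).
  rewrite lognX leq_pmulr // logn_gt0 mem_primes pp fact_gt0 /=.
  by rewrite dvdn_fact // prime_gt0.
have := congr1 (logn p) eqNN'; rewrite !logn_gcd // => eqj.
have -> : logn p N = logn p N' by lia.
apply: SN' => //; apply: contraLR j0 => pN'.
suff : logn p N' = 0 by lia.
by rewrite lognE pp N'0 (negbTE pN').
Qed.

(** * Odd squarefree integers and the effect of one new exponent *)

Lemma logn2_odd b : odd b -> logn 2 b = 0.
Proof. by move=> ob; rewrite lognE dvdn2 ob andbF. Qed.

Lemma squarefree_logn_le1 p b : prime p -> 0 < b -> ~ square_multiples 1 b ->
  logn p b <= 1.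
Proof.
move=> pp b0 sf; rewrite leqNgt; apply/negP => ltj; apply: sf.
by exists p; rewrite ?prime_gt1 // pfactor_dvdn.
Qed.

Definition odd_squarefree : set nat :=
  [set b | odd b /\ ~ square_multiples 1 b].

(** In [2 ^ m * b] with [b] odd and squarefree the exponents are [m], at the prime
    [2], and [1]: allowing the new exponent [m] gains all these integers. *)
Lemma exponentially_pow2_odd_squarefree S S' m : ~ S m -> 0 < m -> S' m -> S' 1 ->
    S `<=` S' ->
  let D := [set 2 ^ m * b | b in odd_squarefree] in
  D `&` exponentially S = set0 /\ D `|` exponentially S `<=` exponentially S'.
Proof.
move=> Sm m0 S'm S'1 SS' D.
have b0 b : odd_squarefree b -> 0 < b by case; case: b.
have log2 b : odd_squarefree b -> logn 2 (2 ^ m * b) = m.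
  move=> [ob sf]; have ? := b0 b (conj ob sf).
  by rewrite lognM ?expn_gt0 // pfactorK // logn2_odd // addn0.
split.
  apply/seteqP; split=> // _ [[b Tb <-] [_ SN]]; apply: Sm.
  rewrite -(log2 b Tb); apply: SN => //.
  by rewrite dvdn_mulr // dvdn_exp.
move=> N [[b Tb <-]|[N0 SN]]; last first.
  by split=> // p pp pN; apply/SS'/SN.
have b_gt0 := b0 b Tb.
split; first by rewrite muln_gt0 expn_gt0.
move=> p pp pN; have [->|p2] := eqVneq p 2; first by rewrite log2.
have logp : logn p (2 ^ m * b) = logn p b.
  by rewrite lognM ?expn_gt0 // lognX (logn_prime p) // (negbTE p2) muln0.
have : 0 < logn p (2 ^ m * b).
  by rewrite logn_gt0 mem_primes pp muln_gt0 expn_gt0 b_gt0.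
have := squarefree_logn_le1 pp b_gt0 Tb.2; rewrite logp => le1 gt0.
by rewrite (_ : logn p b = 1) //; lia.
Qed.

Lemma squarefree_sub_odd :
  ~` square_multiples 1 `<=`
    odd_squarefree `|` [set 2 * b | b in odd_squarefree].
Proof.
move=> b sf; have [ob|eb] := boolP (odd b); first by left.
have bE : b = 2 * b./2 by have := odd_double_half b; lia.
right; exists b./2 => //; split.
  apply: contra_notT sf => ehb; exists 2 => //.
  have hbE : b./2 = 2 * b./2./2.
    by have := odd_double_half b./2; rewrite (negbTE ehb); lia.
  by rewrite bE hbE mulnA dvdn_mulr.
by move=> [d d1 dhb]; apply: sf; exists d => //; rewrite bE dvdn_mull.
Qed.

(** A squarefree integer is odd, or twice an odd squarefree one; so at least half
    of the squarefree integers up to [n] are odd. *)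
Lemma count_squarefree_le n :
  count_upto (~` square_multiples 1) n <= 2 * count_upto odd_squarefree n.
Proof.
apply: leq_trans (count_upto_sub _ (fun i _ => @squarefree_sub_odd i)) _.
apply: leq_trans (count_upto_setU _ _ _) _.
rewrite mul2n -addnn leq_add2l -(@count_upto_scale odd_squarefree 2) //.
by apply: count_upto_leq; lia.
Qed.

Local Open Scope ring_scope.

(** * Frequencies *)

Section Real.
Context {R : realType}.

(** There are at most [n / d ^ 2] multiples of [d ^ 2] up to [n], and
    [1 / d ^ 2 <= 1 / (d - 1) - 1 / d], which telescopes over [d > L]. *)
Lemma count_square_multiples_le (L n : nat) : (0 < L)%N ->
  (count_upto (square_multiples L) n)%:R <= n%:R / L%:R :> R.
Proof.
move=> L0; have [nL|Ln] := leqP n L.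
  have -> : count_upto (square_multiples L) n = 0%N.
    apply/eqP; rewrite -leqn0.
    by apply: leq_trans (count_square_multiples_le_sum _ _) _; rewrite big_geq.
  by rewrite divr_ge0.
have := count_square_multiples_le_sum L n.
rewrite -(ler_nat R) natr_sum => /le_trans; apply.
have tele : \sum_(L.+1 <= d < n.+1) n%:R * (d.-1%:R^-1 - d%:R^-1) =
    n%:R * (L%:R^-1 - n%:R^-1) :> R.
  rewrite -mulr_sumr; congr (_ * _).
  rewrite (telescope_sumr_eq (fun d => - d.-1%:R^-1)) /=; last 2 first.
  - by lia.
  - by move=> k _; rewrite opprK addrC.
  by rewrite opprK addrC.
apply: (@le_trans _ _ (\sum_(L.+1 <= d < n.+1) n%:R * (d.-1%:R^-1 - d%:R^-1))).
  rewrite !big_nat; apply: ler_sum => d /andP[Ld _].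
  have d1 : 0 < d.-1%:R :> R by rewrite ltr0n; lia.
  have dE : d%:R = d.-1%:R + 1 :> R by rewrite natr1 prednK //; lia.
  have d0 : 0 < d%:R :> R by rewrite dE ltr_wpDr.
  have floor_le : (n %/ d ^ 2)%:R <= n%:R / (d%:R * d%:R) :> R.
    have := leq_divM n (d ^ 2); rewrite -mulnn -(ler_nat R) !natrM.
    by rewrite ler_pdivlMr ?mulr_gt0.
  apply: (le_trans floor_le); rewrite ler_wpM2l //.
  have -> : d.-1%:R^-1 - d%:R^-1 = (d.-1%:R * d%:R)^-1 :> R.
    rewrite dE; field; rewrite -dE; apply/andP; split; exact: lt0r_neq0.
  by rewrite lef_pV2 ?posrE ?mulr_gt0 // ler_pM2r // ler_nat leq_pred.
by rewrite tele mulrBr gerBl divr_ge0.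
Qed.

(** Up to [n] there are at most [n / 4] multiples of [4] and at most [n / 2]
    multiples of some [d ^ 2] with [d > 2]. So at least [n / 4] integers are
    squarefree, and at least half of these are odd. Treating [d = 2] apart is
    needed because the telescoping bound for all [d > 1] is only [n]. *)
Lemma count_odd_squarefree_ge n :
  n%:R / 8 <= (count_upto odd_squarefree n)%:R :> R.
Proof.
have split2 : square_multiples 1 `<=` [set i | (4 %| i)%N] `|` square_multiples 2.
  move=> i [d d1 di]; have [d2|d2] := leqP d 2; last by right; exists d.
  by left; move: di; rewrite (_ : d = 2%N) //; lia.
have mult4 : (n %/ 4)%:R <= n%:R / 4 :> R.
  by rewrite ler_pdivlMr // -natrM ler_nat leq_divM.
have nonsf : (count_upto (square_multiples 1) n)%:R <= n%:R / 4 + n%:R / 2 :> R.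
  have le := leq_trans (count_upto_sub n (fun i _ => @split2 i))
                       (count_upto_setU _ _ _).
  rewrite count_upto_dvdn -(ler_nat R) natrD in le.
  by apply: (le_trans le); apply: lerD => //; exact: count_square_multiples_le.
have total : (count_upto (square_multiples 1) n)%:R +
    (count_upto (~` square_multiples 1) n)%:R = n%:R :> R.
  by rewrite -natrD -count_upto_disjoint ?setICr // setUCr count_uptoT.
have := count_squarefree_le n; rewrite -(ler_nat R) natrM.
lra.
Qed.

Definition frequency (A : set nat) (n : nat) : R := (count_upto A n)%:R / n%:R.

Lemma le_frequency_square_multiples (A B : set nat) (L n : nat) : (0 < L)%N ->
    (forall i, (0 < i)%N -> A i -> (B `|` square_multiples L) i) ->
  frequency A n <= frequency B n + L%:R^-1.
Proof.
move=> L0 AB; rewrite /frequency.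
case: n => [|n]; first by rewrite invr0 !mulr0 add0r invr_ge0.
have n0 : 0 < n.+1%:R :> R by rewrite ltr0n.
have := leq_trans (count_upto_sub n.+1 AB) (count_upto_setU _ _ _).
rewrite -(ler_nat R) natrD => le; rewrite ler_pdivrMr // mulrDl divfK ?lt0r_neq0 //.
apply: (le_trans le); rewrite lerD2l mulrC; exact: count_square_multiples_le.
Qed.

(** With [n = q * M + r] and [r < M], only the last [r] terms escape periodicity,
    whence an error of order [M / n]. *)
Lemma frequency_periodic (A : set nat) (M n : nat) : (0 < M)%N -> (0 < n)%N ->
    (forall i, (0 < i)%N -> (i + M \in A)%N = (i \in A)) ->
  `|frequency A M - frequency A n| <= M%:R / n%:R.
Proof.
move=> M0 n0 AM; rewrite /frequency.
have M0R : 0 < M%:R :> R by rewrite ltr0n.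
have n0R : 0 < n%:R :> R by rewrite ltr0n.
set C := count_upto A M; set r := (n %% M)%N; set K := count_upto A r.
have nE : n%:R = (n %/ M)%:R * M%:R + r%:R :> R.
  by rewrite -natrM -natrD -divn_eq.
have -> : (count_upto A n)%:R = (n %/ M)%:R * C%:R + K%:R :> R.
  by rewrite {1}(divn_eq n M) count_upto_period // natrD natrM.
have -> : C%:R / M%:R - ((n %/ M)%:R * C%:R + K%:R) / n%:R =
    (C%:R * r%:R - K%:R * M%:R) / (M%:R * n%:R) :> R.
  by rewrite nE; field; rewrite -nE !lt0r_neq0.
rewrite normrM [X in _ * X]gtr0_norm ?invr_gt0 ?mulr_gt0 //.
rewrite ler_pdivrMr ?mulr_gt0 //.
have -> : M%:R / n%:R * (M%:R * n%:R) = M%:R * M%:R :> R.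
  by field; rewrite lt0r_neq0.
have rM : (r <= M)%N by rewrite ltnW // ltn_pmod.
have CM : (C <= M)%N := count_upto_le A M.
have KM : (K <= M)%N := leq_trans (count_upto_le A r) rM.
have CrM : (C * r <= M * M)%N by rewrite leq_mul.
have KMM : (K * M <= M * M)%N by rewrite leq_mul.
move: CrM KMM; rewrite -!(ler_nat R) !natrM => CrM KMM.
have : 0 <= C%:R * r%:R :> R by rewrite mulr_ge0.
have : 0 <= K%:R * M%:R :> R by rewrite mulr_ge0.
by rewrite ler_norml; lra.
Qed.

Lemma inv_nat_lt (e : R) : 0 < e -> exists2 L, (0 < L)%N & L%:R^-1 < e.
Proof.
move=> e0; have [L _ /(_ L (leqnn L))] := near_infty_natSinv_lt (PosNum e0).
by exists L.+1.
Qed.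

(** * The density of the exponentially S-numbers *)

Lemma frequency_exponentially_cvg (S : set nat) : S 1%N ->
  cvg (frequency (exponentially S) n @[n --> \oo]).
Proof.
move=> S1; apply: cauchy_cvg; apply: cauchy_exP => e e0.
have e20 : 0 < e / 2 by rewrite divr_gt0.
have [L L0 Le] := inv_nat_lt e20.
pose M := (L`! ^ (2 * L))%N.
have M0 : (0 < M)%N by rewrite expn_gt0 fact_gt0.
pose P := gcd_saturation M (exponentially S).
exists (frequency P M).
have M2e : 0 <= M%:R / (e / 2) by rewrite divr_ge0 // ltW.
exists (Num.bound (M%:R / (e / 2))) => // n /= boundn.
have lt_n : M%:R / (e / 2) < n%:R.
  by apply: (lt_le_trans (archi_boundP M2e)); rewrite ler_nat.
have n0 : (0 < n)%N by rewrite -(ltr0n R); exact: le_lt_trans lt_n.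
have PM : `|frequency P M - frequency P n| <= M%:R / n%:R.
  by apply: frequency_periodic => // i _; exact: gcd_saturation_period.
have Mn : M%:R / n%:R < e / 2.
  by rewrite ltr_pdivrMr ?ltr0n // mulrC -ltr_pdivrMr.
have SP : frequency (exponentially S) n <= frequency P n.
  rewrite ler_wpM2r ?invr_ge0 // ler_nat; apply: count_upto_sub => i _ Si.
  by exists i.
have PS : frequency P n <= frequency (exponentially S) n + L%:R^-1.
  by apply: le_frequency_square_multiples => // i; exact: gcd_saturation_exponentially.
rewrite /ball /=; move: PM; rewrite ler_norml ltr_norml; lra.
Qed.

Lemma density_le_agree (S S' : set nat) L : S 1%N -> S' 1%N -> (0 < L)%N ->
    (forall j, (j < 2 * L)%N -> S j -> S' j) ->
  density R (exponentially S) <= density R (exponentially S') + L%:R^-1.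
Proof.
move=> S1 S'1 L0 SS'.
have cS' : frequency (exponentially S') n + L%:R^-1 @[n --> \oo]
    --> density R (exponentially S') + L%:R^-1.
  by apply: cvgD; [exact: frequency_exponentially_cvg|exact: cvg_cst].
apply: ler_cvg_to (frequency_exponentially_cvg S1) cS' _.
apply: nearW => n; apply: le_frequency_square_multiples => // i _.
exact: exponentially_approx.
Qed.

Lemma density_dist_agree (S S' : set nat) L : S 1%N -> S' 1%N -> (0 < L)%N ->
    (forall j, (j < 2 * L)%N -> S j <-> S' j) ->
  `|density R (exponentially S) - density R (exponentially S')| <= L%:R^-1.
Proof.
move=> S1 S'1 L0 SS'.
have := density_le_agree S1 S'1 L0 (fun j jL => (SS' j jL).1).
have := density_le_agree S'1 S1 L0 (fun j jL => (SS' j jL).2).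
rewrite ler_norml; lra.
Qed.

(** The limits are compared along the subsequence [2 ^ m * n]: up to [2 ^ m * n]
    there are as many integers [2 ^ m * b] with [b] odd and squarefree as there
    are such [b] up to [n], hence at least [n / 8]. *)
Lemma density_lt_setU1 (S : set nat) m : S 1%N -> (0 < m)%N -> ~ S m ->
  density R (exponentially S) < density R (exponentially (m |` S)).
Proof.
move=> S1 m0 Sm.
have S'1 : (m |` S) 1%N by right.
have [D0 DS] := @exponentially_pow2_odd_squarefree S (m |` S) m
  Sm m0 (or_introl erefl) S'1 (@subsetUr _ _ _).
have m2 : (0 < 2 ^ m)%N by rewrite expn_gt0.
have cvg_sub (S' : set nat) : S' 1%N ->
    frequency (exponentially S') (2 ^ m * n)%N @[n --> \oo]
    --> density R (exponentially S').
  move=> S'1'; apply: (cvg_comp _ _ (cvg_mulnl _ m2)).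
  exact: frequency_exponentially_cvg.
set delta : R := (8 * (2 ^ m)%N%:R)^-1.
have delta0 : 0 < delta by rewrite invr_gt0 mulr_gt0 // ltr0n.
suff : density R (exponentially S) + delta <= density R (exponentially (m |` S)) by lra.
have cvg_delta : frequency (exponentially S) (2 ^ m * n)%N + delta @[n --> \oo]
    --> density R (exponentially S) + delta.
  by apply: cvgD; [exact: cvg_sub|exact: cvg_cst].
apply: ler_cvg_to cvg_delta (cvg_sub _ S'1) _.
exists 1%N => // n /= n0; rewrite /frequency.
have n0R : 0 < n%:R :> R by rewrite ltr0n.
have m2R : 0 < (2 ^ m)%N%:R :> R by rewrite ltr0n.
have := count_upto_sub (2 ^ m * n)%N (fun i _ => DS i).
rewrite count_upto_disjoint // count_upto_scale // -(ler_nat R) natrD => le.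
rewrite (natrM R (2 ^ m) n) ler_pdivlMr ?mulr_gt0 //.
rewrite mulrDl divfK ?mulf_neq0 ?lt0r_neq0 //.
have -> : delta * ((2 ^ m)%N%:R * n%:R) = n%:R / 8.
  by rewrite /delta; field; rewrite lt0r_neq0.
by apply: le_trans le; rewrite addrC lerD2r count_odd_squarefree_ge.
Qed.

(** * The set of densities *)

(** The bits at [0] and [1] are ignored, so that every point of the Cantor space
    gives an exponent set. *)
Definition exponents_of (b : cantor_space) : set nat :=
  [set n | n = 1%N \/ (1 < n)%N /\ b n].

Lemma range_density_exponents_of :
  [set density R (exponentially S) | S in exponent_sets] =
  range (fun b => density R (exponentially (exponents_of b))).
Proof.
apply/seteqP; split; last first.
  move=> _ [b _ <-]; exists (exponents_of b) => //; split; first by left.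
  by case=> // -[].
move=> _ [x [x1 x0] <-]; exists (fun n => n \in x) => //; congr (density R (exponentially _)).
apply/seteqP; split=> n; first by case=> [->//|[_ /set_mem]].
case: n => // -[|n] xn; [by left|right; split => //]; exact: mem_set.
Qed.

(** A point of the Cantor space has a neighbourhood on which the first [2 * L]
    bits are constant, and there the density varies by at most [1 / L]. *)
Lemma continuous_density_exponents_of :
  continuous (fun b => density R (exponentially (exponents_of b))).
Proof.
move=> b; apply/cvgrPdist_lt => e e0; have [L L0 Le] := inv_nat_lt e0.
have agree : nbhs b [set b' : cantor_space |
    forall j : 'I_(2 * L), b' (val j) = b (val j)].
  apply: (@filter_forall _ _
    (fun j => [set b' : cantor_space | b' (val j) = b (val j)]) _
    (nbhs_filter b)) => j.
  have := @proj_continuous _ (fun=> bool) (val j) b.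
  move=> projb; apply: (projb [set b (val j)]); exact: discrete_set1.
apply: filterS agree => b' bb'; apply: le_lt_trans Le.
apply: density_dist_agree => //; [by left|by left|] => j jL.
by rewrite /exponents_of /= (bb' (Ordinal jL)).
Qed.

Lemma closed_density_exponentially :
  closed [set density R (exponentially S) | S in exponent_sets].
Proof.
rewrite range_density_exponents_of; apply: compact_closed.
  exact: Rhausdorff.
apply: continuous_compact; last exact: cantor_space_compact.
exact/continuous_subspaceT/continuous_density_exponents_of.
Qed.

Lemma exponent_sets_perturb (S : set nat) (m : nat) : exponent_sets S -> (1 < m)%N ->
  exists S', [/\ exponent_sets S', forall j, (j < m)%N -> S j <-> S' j &
    density R (exponentially S') != density R (exponentially S)].
Proof.
move=> [S1 S0] m1; have m0 := ltnW m1.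
have [Sm|Sm] := pselect (S m); last first.
  exists (m |` S); split.
  - by split; [right|case=> // mE; rewrite -mE in m1].
  - by move=> j jm; split; [right|case=> // jE; rewrite jE ltnn in jm].
  - by rewrite gt_eqF // density_lt_setU1.
have S'1 : (S `\ m) 1%N by split=> // mE; rewrite -mE in m1.
exists (S `\ m); split.
- by split=> // -[].
- by move=> j jm; split=> [Sj|[]//]; split=> // jE; rewrite jE ltnn in jm.
- have := density_lt_setU1 S'1 m0 (fun H => H.2 erefl).
  by rewrite setD1K // => lt; rewrite lt_eqF.
Qed.

End Real.

Theorem theorem3 (R : realType) :
  perfect_set [set density R (exponentially S) | S in exponent_sets].
Proof.
have cl := @closed_density_exponentially R.
split=> //; apply/seteqP; split.
  by move=> x /subset_limit_point; exact: cl.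
move=> _ [S eS <-] U /nbhs_ballP[e /= e0 ballU].
have [L L0 Le] := inv_nat_lt e0.
have [|S' [eS' SS' neq]] := exponent_sets_perturb (R := R) eS (m := (2 * L)%N); first by lia.
exists (density R (exponentially S')); split=> //; first by exists S'.
apply: ballU; apply: le_lt_trans Le.
by apply: density_dist_agree => //; [case: eS|case: eS'].
Qed.
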